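(* Let $G,G',H,H'$ be graphs, and let $G'\to G$ and $H'\to H$ be homomorphisms. (1) We have $\mathrm{C}(G';H)\leq \mathrm{C}(G;H)\leq \mathrm{C}(G;H')$. (2) Moreover, if the homomorphisms $G'\to G$ and $H'\to H$ are injective, then $\mathrm{IC}(G';H)\leq \mathrm{IC}(G;H)\leq \mathrm{IC}(G;H')$.
   Context: ''Graph'' means either an undirected graph (loops allowed) or a directed graph (a set of vertices with a binary relation), without multiple edges; all graphs in the statement are of the same kind. The vertex and edge (arc) sets of $G$ are $V(G)$, $E(G)$. A homomorphism $f:G\to H$ is a map $f:V(G)\to V(H)$ with $f(u)f(v)\in E(H)$ whenever $uv\in E(G)$; it is injective if it is injective on vertices and the induced map on edges is injective (the former implies the latter). A subgraph of $G$ is a graph whose vertex and edge sets are subsets of $V(G)$, $E(G)$. The union $G_1\cup\cdots\cup G_k$ has vertex set $\bigcup_i V(G_i)$ and edge set $\bigcup_i E(G_i)$. The hom-complexity $\mathrm{C}(G;H)$ is the least positive integer $k$ such that there are subgraphs $G_1,\dots,G_k$ of $G$ with $G=G_1\cup\cdots\cup G_k$ and, for each $i$, a homomorphism $G_i\to H$; $\mathrm{C}(G;H)=\infty$ if no such $k$ exists. The injective hom-complexity $\mathrm{IC}(G;H)$ is defined in the same way, requiring for each $i$ an injective homomorphism $G_i\to H$. *)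

(* Defs.v *)
From mathcomp Require Import all_boot all_order all_algebra.
From mathcomp Require Import boolp classical_sets constructive_ereal.

Set Implicit Arguments.
Unset Strict Implicit.
Unset Printing Implicit Defensive.

Local Open Scope classical_set_scope.

Inductive graph_kind := Undirected | Directed.

(* A graph, possibly infinite or empty, whose vertices form a subset of an
   ambient type [T].  An edge [uv] of an undirected graph is represented by both
   ordered pairs [(u, v)] and [(v, u)], so that inclusions and unions of edge
   sets are those of the sets of ordered pairs. *)
Record graph (d : graph_kind) (T : Type) := Graph {
  vset : set T;
  eset : set (T * T);
  eset_sub : eset `<=` vset `*` vset;
  eset_sym : d = Undirected -> forall u v, eset (u, v) -> eset (v, u)
}.

(* Equality of the edges represented by two ordered pairs. *)
Definition same_edge (d : graph_kind) (T : Type) (e e' : T * T) : Prop :=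
  e = e' \/ (d = Undirected /\ e = (e'.2, e'.1)).

(* The coercion of [vset G] to a type is the subtype of its elements, so [f] is
   a map between vertex sets only. *)
Definition is_hom d T U (G : graph d T) (H : graph d U)
    (f : vset G -> vset H) : Prop :=
  forall u v : vset G,
    eset G (\val u, \val v) -> eset H (\val (f u), \val (f v)).

Definition edge_injective d T U (G : graph d T) (H : graph d U)
    (f : vset G -> vset H) : Prop :=
  forall u v u' v' : vset G,
    eset G (\val u, \val v) -> eset G (\val u', \val v') ->
    same_edge d (\val (f u), \val (f v)) (\val (f u'), \val (f v')) ->
    same_edge d (\val u, \val v) (\val u', \val v').

Definition is_inj_hom d T U (G : graph d T) (H : graph d U)
    (f : vset G -> vset H) : Prop :=
  [/\ is_hom f, injective f & edge_injective f].

Definition subgraph d T (F G : graph d T) : Prop :=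
  vset F `<=` vset G /\ eset F `<=` eset G.

Definition is_union d T k (G : graph d T) (F : 'I_k -> graph d T) : Prop :=
  vset G = \bigcup_i vset (F i) /\ eset G = \bigcup_i eset (F i).

Definition hom_cover d T U (G : graph d T) (H : graph d U) (k : nat) : Prop :=
  exists F : 'I_k -> graph d T,
    [/\ forall i, subgraph (F i) G, is_union G F &
        forall i, exists f : vset (F i) -> vset H, is_hom f].

Definition inj_hom_cover d T U (G : graph d T) (H : graph d U) (k : nat)
    : Prop :=
  exists F : 'I_k -> graph d T,
    [/\ forall i, subgraph (F i) G, is_union G F &
        forall i, exists f : vset (F i) -> vset H, is_inj_hom f].

(* The extended integers [\bar int] provide the value +oo and the order. *)
Definition least_pos (P : nat -> Prop) : \bar int :=
  match pselect (exists k, (0 < k)%N && `[< P k >]) with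
  | left exP => (Posz (ex_minn exP))%:E
  | right _ => +oo%E
  end.

Definition hom_complexity d T U (G : graph d T) (H : graph d U) : \bar int :=
  least_pos (hom_cover G H).

Definition inj_hom_complexity d T U (G : graph d T) (H : graph d U)
    : \bar int :=
  least_pos (inj_hom_cover G H).

(* Main.v *)
Require Import Defs.
From mathcomp Require Import all_boot all_order all_algebra.
From mathcomp Require Import boolp classical_sets constructive_ereal.

(** Given a cover of [G] by subgraphs [F i] mapping to [H], the preimages of the
    [F i] under [G' -> G] cover [G'] and map to [H] through the [F i].  Composing
    with [H' -> H] turns maps [F i -> H'] into maps [F i -> H].  Injectivity is
    preserved, and inclusions between the sets of sizes of covers reverse the
    order of their minima. *)

Local Open Scope classical_set_scope.

Lemma le_least_pos (P Q : nat -> Prop) :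
  (forall k, P k -> Q k) -> (least_pos Q <= least_pos P)%E.
Proof.
move=> PQ; rewrite /least_pos.
(* [leey] settles the cases where the right side is [+oo]. In the remaining infinite case, a
   positive [k] with [P k] contradicts [nexQ]. *)
case: pselect => [exQ|nexQ]; case: pselect => [exP|_]; rewrite ?leey //; last first.
  case: nexQ; case: exP => k /andP[k0 /asboolP Pk].
  by exists k; rewrite k0; apply/asboolP/PQ.
rewrite lee_fin; case: ex_minnP => m _ mmin; case: ex_minnP => n /andP[n0 /asboolP Pn] _.
by apply: mmin; rewrite n0; apply/asboolP/PQ.
Qed.

Section Composition.
Context {d : graph_kind} {T U V : Type}.
Context {G : graph d T} {H : graph d U} {K : graph d V}.
Context {f : vset G -> vset H} {g : vset H -> vset K}.

Lemma is_hom_comp : is_hom f -> is_hom g -> is_hom (g \o f).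
Proof. by move=> hf hg u v /hf/hg. Qed.

Lemma is_inj_hom_comp : is_inj_hom f -> is_inj_hom g -> is_inj_hom (g \o f).
Proof.
move=> [hf fI fE] [hg gI gE]; split; first exact: is_hom_comp.
  exact: inj_comp.
(* Edge injectivity of [g] applies to the images under [f], which are edges of [H] by [hf]; that of
   [f] then goes back to [G]. *)
move=> u v u' v' uv uv' e; apply: fE => //.
by apply: gE => //; apply: hf.
Qed.

End Composition.

Section Preimage.
Context {d : graph_kind} {T T' : Type} {G : graph d T} {G' : graph d T'}.
Variable f : vset G' -> vset G.

(** Since [f] acts on the subtype of vertices, a point of [T'] must first be exhibited as the value
    of some [y]. *)
Definition preim_vset (F : graph d T) : set T' :=
  [set x | exists2 y : vset G', \val y = x & vset F (\val (f y))].

(** Non-adjacent vertices of [G'] may be sent to an edge of [F]; the first conjunct excludes such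
    pairs, so that a subgraph of [G'] results. *)
Definition preim_eset (F : graph d T) : set (T' * T') :=
  [set e | eset G' e /\ exists u v : vset G',
     e = (\val u, \val v) /\ eset F (\val (f u), \val (f v))].

Lemma preim_eset_sub F : preim_eset F `<=` preim_vset F `*` preim_vset F.
Proof.
move=> _ [_ [u [v [-> /eset_sub[/= Fu Fv]]]]].
by split; [exists u|exists v].
Qed.

Lemma preim_eset_sym F :
  d = Undirected -> forall u v, preim_eset F (u, v) -> preim_eset F (v, u).
Proof.
move=> dU u v [uv [x [y [[ux vy] xy]]]]; split; first exact: eset_sym.
by exists y, x; rewrite ux vy; split=> //; apply: eset_sym.
Qed.

Definition preim_graph (F : graph d T) : graph d T' :=
  Graph (@preim_eset_sub F) (@preim_eset_sym F).

Lemma preim_graph_sub F : subgraph (preim_graph F) G'.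
Proof.
by split=> [_ [y <- _]|e []//]; exact: (set_mem (valP y)).
Qed.

Lemma preim_graph_union k (F : 'I_k -> graph d T) :
  is_hom f -> is_union G F -> is_union G' (fun i => preim_graph (F i)).
Proof.
move=> hf [GV GE]; split; apply/seteqP; split.
- move=> x G'x; pose y : vset G' := exist _ x (mem_set G'x).
  have [i _ Fi] : (\bigcup_i vset (F i)) (\val (f y)).
    by rewrite -GV; exact: (set_mem (valP (f y))).
  by exists i => //; exists y.
- by move=> x [i _ /(preim_graph_sub (F i)).1].
- move=> [a b] ab; have [/= G'a G'b] := eset_sub ab.
  pose u : vset G' := exist _ a (mem_set G'a).
  pose v : vset G' := exist _ b (mem_set G'b).
  (* The image of an edge of [G'] is an edge of [G], hence lies in some [F i], and the edge itself
     in the preimage of that [F i]. *)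
  have : eset G (\val (f u), \val (f v)) by exact: hf.
  by rewrite GE => -[i _ Fi]; exists i => //; split=> //; exists u, v.
- by move=> e [i _ /(preim_graph_sub (F i)).2].
Qed.

(** This [r] is the restriction of [f]. Its source and target are other subtypes than those of [f],
    so the two maps are compared through underlying values. *)
Lemma preim_graph_map F :
  exists r : vset (preim_graph F) -> vset F, forall x,
    exists2 y : vset G', \val y = \val x & \val (r x) = \val (f y).
Proof.
suff /choice[r rP] : forall x : vset (preim_graph F), exists z : vset F,
    exists2 y : vset G', \val y = \val x & \val z = \val (f y) by exists r.
move=> x; have [y yx Ffy] := set_mem (valP x).
by exists (exist _ (\val (f y)) (mem_set Ffy)), y.
Qed.

Lemma preim_graph_hom F :
  exists r : vset (preim_graph F) -> vset F,
    is_hom r /\ (is_inj_hom f -> is_inj_hom r).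
Proof.
have [r rP] := preim_graph_map F; exists r.
have hr : is_hom r.
  (* The edge provides the lifts [x], [y] to [G'], and [rP] provides [a], [b]; they agree because
     [\val] is injective. *)
  move=> u v [_ [x [y [[ux vy] xy]]]].
  have [a au ->] := rP u; have [b bv ->] := rP v.
  have -> : a = x by apply: val_inj; rewrite au.
  by have -> : b = y by apply: val_inj; rewrite bv.
split=> // -[hf fI fE]; split=> // [x x' rxx'|u v u' v' [uv _] [uv' _]].
  have [y yx ry] := rP x; have [y' yx' ry'] := rP x'.
  apply: val_inj; rewrite -yx -yx'; congr (\val _).
  by apply: fI; apply: val_inj; rewrite -ry -ry' rxx'.
(* Edges of the preimage are edges of [G'] on which [r] takes the values of [f], so [fE] applies. *)
have [a au ->] := rP u; have [b bv ->] := rP v.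
have [a' au' ->] := rP u'; have [b' bv' ->] := rP v'.
by move: uv uv'; rewrite -au -bv -au' -bv'; exact: fE.
Qed.

End Preimage.

Section Monotonicity.
Context {d : graph_kind} {T T' U V : Type}.
Context {G : graph d T} {G' : graph d T'} {H : graph d U} {K : graph d V}.

Lemma hom_cover_preim {f : vset G' -> vset G} {k} :
  is_hom f -> hom_cover G H k -> hom_cover G' H k.
Proof.
move=> hf [F [_ FU Fh]]; exists (fun i => preim_graph f (F i)); split.
- by move=> i; exact: preim_graph_sub.
- exact: preim_graph_union.
- move=> i; have [h hh] := Fh i; have [r [hr _]] := preim_graph_hom f (F i).
  by exists (h \o r); exact: is_hom_comp.
Qed.

Lemma inj_hom_cover_preim {f : vset G' -> vset G} {k} :
  is_inj_hom f -> inj_hom_cover G H k -> inj_hom_cover G' H k.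
Proof.
move=> hf [F [_ FU Fh]]; exists (fun i => preim_graph f (F i)); split.
- by move=> i; exact: preim_graph_sub.
- by apply: preim_graph_union => //; case: hf.
- move=> i; have [h hh] := Fh i; have [r [_ /(_ hf) hr]] := preim_graph_hom f (F i).
  by exists (h \o r); exact: is_inj_hom_comp.
Qed.

Lemma hom_cover_comp {g : vset H -> vset K} {k} :
  is_hom g -> hom_cover G H k -> hom_cover G K k.
Proof.
move=> hg [F [FG FU Fh]]; exists F; split=> // i; have [h hh] := Fh i.
by exists (g \o h); exact: is_hom_comp.
Qed.

Lemma inj_hom_cover_comp {g : vset H -> vset K} {k} :
  is_inj_hom g -> inj_hom_cover G H k -> inj_hom_cover G K k.
Proof.
move=> hg [F [FG FU Fh]]; exists F; split=> // i; have [h hh] := Fh i.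
by exists (g \o h); exact: is_inj_hom_comp.
Qed.

End Monotonicity.

Theorem theorem3p8 (d : graph_kind) (TG TG' TH TH' : Type)
    (G : graph d TG) (G' : graph d TG') (H : graph d TH) (H' : graph d TH')
    (f : vset G' -> vset G) (g : vset H' -> vset H)
    (hf : is_hom f) (hg : is_hom g) :
  (hom_complexity G' H <= hom_complexity G H <= hom_complexity G H')%E /\
  (is_inj_hom f -> is_inj_hom g ->
   (inj_hom_complexity G' H <= inj_hom_complexity G H
      <= inj_hom_complexity G H')%E).
Proof.
(* Each inequality reduces to turning a cover of size [k] for the larger side into one of the same
   size for the smaller side. *)
split=> [|fI gI]; apply/andP; split; apply: le_least_pos => k.
- exact: hom_cover_preim hf.
- exact: hom_cover_comp hg.
- exact: inj_hom_cover_preim fI.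
- exact: inj_hom_cover_comp gI.
Qed.
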